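(* Let $(u^n,v^n,p^n)_{n\ge 0}$ be generated by the semi-discrete semi-implicit scheme described in the context. If the initial data $(u^0,v^0,p^0)$ satisfy $$0\le u^0(x)\le \|u^0\|_{L^\infty(\mathbb{R}^d)},\qquad 0\le v^0(x)\le \|v^0\|_{L^\infty(\mathbb{R}^d)},\qquad 0\le p^0(x)\le 1 ,$$ then the scheme satisfies the non-negativity and upper-bound preserving properties, that is, for all $n\ge 0$, $$0\le u^n\le \|u^0\|_{L^\infty(\mathbb{R}^d)},\qquad 0\le v^n\le \|v^0\|_{L^\infty(\mathbb{R}^d)},\qquad 0\le p^n\le 1 .$$
   Context: Let $\epsilon,\lambda,d_1,d_2>0$ be constants. The scheme discretizes in time, with step size $\tau>0$ and $t_n=n\tau$, the fast reaction--diffusion system $$\partial_t u-d_1\Delta u=-\tfrac1\epsilon u[v+\lambda(1-p)],\quad \partial_t v-d_2\Delta v=-\tfrac1\epsilon v(u+\lambda p),\quad \partial_t p=\tfrac1\epsilon[(1-p)u-vp],\quad x\in\mathbb{R}^d,\ t>0,$$ with initial data $u^0(x),v^0(x),p^0(x)$ (which may depend on $\epsilon$). The semi-discrete semi-implicit scheme determines successively $p^{n+1}$, $u^{n+1}$, $v^{n+1}$ (functions on $\mathbb{R}^d$ approximating the solution at $t=t_{n+1}$) from $(u^n,v^n,p^n)$, $n=0,1,\dots$, by $$\frac{p^{n+1}-p^n}{\tau}=\frac1\epsilon\left[(1-p^{n+1})u^n-v^np^{n+1}\right],$$ $$\frac{u^{n+1}-u^n}{\tau}-d_1\Delta u^{n+1}=-\frac1\epsilon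 u^{n+1}\left[v^n+\lambda(1-p^{n+1})\right],$$ $$\frac{v^{n+1}-v^n}{\tau}-d_2\Delta v^{n+1}=-\frac1\epsilon v^{n+1}\left(u^{n+1}+\lambda p^{n+1}\right).$$
   Formalization: For n ≥ 1 the functions u^n, v^n are taken to be bounded, continuous, with classical second pure partial derivatives, the equations holding at every x; without boundedness the scheme also admits exponentially growing solutions (cosh type) that violate the bounds. *)

(* Defs.v *)
From HB Require Import structures.
From mathcomp Require Import all_boot all_order all_algebra.
From mathcomp Require Import all_classical all_reals all_analysis.

Set Implicit Arguments.
Unset Strict Implicit.
Unset Printing Implicit Defensive.

Import Order.TTheory GRing.Theory Num.Theory.
Import numFieldNormedType.Exports.

Local Open Scope classical_set_scope.
Local Open Scope ring_scope.

(* d-dimensional Lebesgue measure, as an iterated product on d-tuples (which,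
   unlike row vectors, carry the product sigma-algebra in the library). *)
Section LebesgueRd.
Variable R : realType.
Local Notation Rb := (measurableTypeR R).

Definition tuple_of_pair (d : nat) (z : Rb * d.-tuple Rb) : d.+1.-tuple Rb :=
  [tuple of z.1 :: z.2].

Lemma measurable_tuple_of_pair d : measurable_fun setT (@tuple_of_pair d).
Proof.
by apply: (@measurable_cons _ _ _ Rb fst d snd); [exact: measurable_fst | exact: measurable_snd].
Qed.

Section Step.
Variables (d : nat) (mu : {sigma_finite_measure set (d.-tuple Rb) -> \bar R}).

Definition lebesgue_cons : set (d.+1.-tuple Rb) -> \bar R :=
  pushforward (lebesgue_measure \x mu)%E (@tuple_of_pair d).

Let lebesgue_cons0 : lebesgue_cons set0 = 0%E.
Proof. by rewrite /lebesgue_cons /pushforward preimage_set0 measure0. Qed.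

Let lebesgue_cons_ge0 A : (0 <= lebesgue_cons A)%E.
Proof. by rewrite /lebesgue_cons /pushforward; exact: measure_ge0. Qed.

Let lebesgue_cons_sigma_additive : semi_sigma_additive lebesgue_cons.
Proof.
move=> F mF tF mUF; rewrite /lebesgue_cons /pushforward preimage_bigcup.
have mpre A : measurable A -> measurable (@tuple_of_pair d @^-1` A).
  by move=> mA; rewrite -[X in measurable X]setTI; exact: measurable_tuple_of_pair.
apply: measure_semi_sigma_additive.
- by move=> n; exact: mpre.
- apply/trivIsetP => /= i j _ _ ij; rewrite -preimage_setI.
  by move/trivIsetP : tF => /(_ _ _ _ _ ij) ->//; rewrite preimage_set0.
- by rewrite -preimage_bigcup; exact: mpre.
Qed.

HB.instance Definition _ := isMeasure.Build _ _ _ lebesgue_cons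
  lebesgue_cons0 lebesgue_cons_ge0 lebesgue_cons_sigma_additive.

Let lebesgue_cons_sigma_finite : sigma_finite setT lebesgue_cons.
Proof.
have /sigma_finiteP[F [TF ndF Foo]] :=
  sigma_finiteT (@lebesgue_measure R : {sigma_finite_measure set Rb -> \bar R}).
have /sigma_finiteP[G [TG ndG Goo]] := sigma_finiteT mu.
exists (fun n => [set t : d.+1.-tuple Rb |
    F n (thead t) /\ G n [tuple of behead t]]).
  rewrite predeqE => t; split => // _.
  have [n _ Fn] : (\bigcup_i F i) (thead t) by rewrite -TF.
  have [m _ Gm] : (\bigcup_i G i) [tuple of behead t] by rewrite -TG.
  exists (maxn n m) => //; split.
    by move: (thead t) Fn; exact/subsetPset/ndF/leq_maxl.
  by move: [tuple of behead t] Gm; exact/subsetPset/ndG/leq_maxr.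
move=> n; have [mF Fn] := Foo n; have [mG Gn] := Goo n; split.
  apply: (@measurableI _ _ [set t | F n (thead t)]).
    rewrite -[X in measurable X]setTI.
    exact: (@measurable_tnth _ Rb d.+1 ord0 measurableT).
  rewrite -[X in measurable X]setTI.
  exact: (@measurable_behead _ Rb d measurableT).
rewrite /lebesgue_cons /pushforward.
rewrite (_ : _ @^-1` _ = F n `*` G n); last first.
  rewrite predeqE => -[x t] /=.
  by rewrite theadE (_ : [tuple of behead (tuple_of_pair (x, t))] = t :> d.-tuple Rb)//;
    exact/val_inj.
by rewrite product_measure1E// lte_mul_pinfty// ge0_fin_numE.
Qed.

HB.instance Definition _ := Measure_isSigmaFinite.Build _ _ _ lebesgue_cons
  lebesgue_cons_sigma_finite.

End Step.

Fixpoint lebesgue_tuple (d : nat) :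
    {sigma_finite_measure set (d.-tuple Rb) -> \bar R} :=
  if d is d'.+1 then lebesgue_cons (lebesgue_tuple d')
  else \d_([tuple] : 0.-tuple Rb).

End LebesgueRd.

Section Notions.
Variables (R : realType) (d : nat).
Implicit Types f : 'rV[R]_d -> R.

Definition rV_of_tuple (t : d.-tuple (measurableTypeR R)) : 'rV[R]_d :=
  \row_i tnth t i.

Definition Linfty_norm f : \bar R :=
  'N[lebesgue_tuple R d]_+oo [EFin \o f \o rV_of_tuple]%E.

Definition partial (i : 'I_d) f : 'rV[R]_d -> R :=
  fun x => 'D_(delta_mx 0 i) f x.

Definition laplacian f : 'rV[R]_d -> R :=
  fun x => \sum_(i < d) partial i (partial i f) x.

(* [derive] is total, so existence of the second partials entering the
   Laplacian is a separate requirement; every bounded C^2 function qualifies. *)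
Definition bounded_classical f : Prop :=
  [/\ continuous f,
      forall i x, derivable f x (delta_mx 0 i) /\
                  derivable (partial i f) x (delta_mx 0 i) &
      [bounded f x | x in setT]].

(* Boundedness selects the solution of each elliptic equation on the whole
   space: without it exponentially growing homogeneous solutions could be
   added. Nothing is required of the data at time 0. *)
Definition scheme (eps lam d1 d2 tau : R) (u v p : nat -> 'rV[R]_d -> R) : Prop :=
  forall n,
    [/\ bounded_classical (u n.+1), bounded_classical (v n.+1) &
      forall x,
        [/\ (p n.+1 x - p n x) / tau
              = eps^-1 * ((1 - p n.+1 x) * u n x - v n x * p n.+1 x),
            (u n.+1 x - u n x) / tau - d1 * laplacian (u n.+1) x
              = - eps^-1 * (u n.+1 x * (v n x + lam * (1 - p n.+1 x))) &
            (v n.+1 x - v n x) / tau - d2 * laplacian (v n.+1) x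
              = - eps^-1 * (v n.+1 x * (u n.+1 x + lam * p n.+1 x))]].

End Notions.

(* Main.v *)
Require Import Defs.
From HB Require Import structures.
From mathcomp Require Import all_boot all_order all_algebra.
From mathcomp Require Import all_classical all_reals all_analysis.
From mathcomp Require Import ring lra.

Import Order.TTheory GRing.Theory Num.Theory.
Import numFieldNormedType.Exports.

Local Open Scope classical_set_scope.
Local Open Scope ring_scope.

(** The bounds propagate from one time step to the next, and each new function
    is controlled by the one it replaces.

    The equation for [p] is pointwise and linear in the new value, which it
    expresses as a convex combination of [0], [1] and the old value; this is
    [proportion_step_bounds].

    Given [p] between 0 and 1, the equations for [u] and [v] share one form,
    f - tau D (laplacian f) = g - a f, where [g] is the old function and the
    zeroth-order coefficient [a] is nonnegative.  At a negative minimum of [f]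
    the term - a f and the Laplacian are nonnegative, so f >= g >= 0 there, a
    contradiction.  Once f >= 0 is known, at a maximum both terms are
    nonpositive, so that f <= g.  This is [implicit_step_bounds].  It
    transports any extended real upper bound, in particular the sup norm of the
    initial datum, which dominates that datum by hypothesis.

    On the whole space a bounded function need not attain its extrema.
    [maximum_principle] therefore maximizes f - delta |x|^2, which tends to
    -oo at infinity and so has a maximum point.  There the Laplacian of [f] is
    at most 2 d delta, and delta is finally sent to 0.  Only the pure second
    partial derivatives exist, without continuity, so this last estimate is
    made along each coordinate line with a one-variable second derivative
    test. *)

(** If the second derivative were positive at the maximum, the first one, which
    vanishes there, would be positive just to the right, and the mean value
    theorem would produce a larger value. *)
Lemma second_derivative_at_max_le0 (R : realType) (phi dphi : R -> R)
    (a l : R) :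
  (forall t : R, is_derive t 1 phi (dphi t)) -> is_derive a 1 dphi l ->
  (forall t, phi t <= phi a) -> l <= 0.
Proof.
move=> dphiE d2phi amax.
have dphia0 : dphi a = 0.
  have d0 : is_derive a 1 phi 0.
    apply: (@derive1_at_max _ phi (a - 1) (a + 1) a) => [|t _||t _].
    - lra.
    - by have [] := dphiE t.
    - by rewrite in_itv /=; lra.
    - exact: amax.
  by have [_ <-] := dphiE a; have [_ ->] := d0.
rewrite leNgt; apply/negP => l0.
have [d2v d2E] := d2phi.
have cvgl : h^-1 *: (dphi (h *: 1 + a) - dphi a) @[h --> 0^'] --> l.
  by rewrite -d2E; exact: d2v.
have [e /= e0 he] := iffLR (nbhs_ballP _ _) (cvgr_gt l cvgl 0 l0).
have dpos t : a < t < a + e -> 0 < dphi t.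
  move=> /andP[at_ te].
  have := he (t - a); rewrite /ball /= sub0r normrN gtr0_norm ?subr_gt0//.
  rewrite ltrBlDl => /(_ te); rewrite subr_eq0 gt_eqF// => /(_ isT).
  by rewrite dphia0 subr0 [_%:A]mulr1 subrK pmulr_rgt0// invr_gt0 subr_gt0.
have aelt : a < a + e / 2 by rewrite ltrDl divr_gt0.
have phicont : {within `[a, a + e / 2], continuous phi}.
  by apply: derivable_within_continuous => t _; have [] := dphiE t.
have [c] := MVT aelt (fun t _ => dphiE t) phicont.
rewrite in_itv /= => /andP[ac ce] E.
have : 0 < phi (a + e / 2) - phi a.
  rewrite E mulr_gt0// ?dpos ?ac /=; lra.
by rewrite subr_gt0 ltNge amax.
Qed.

Lemma is_derive_along_line {R : realType} {V W : normedModType R} {f : V -> W}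
    {x v : V} {t : R} : derivable f (t *: v + x) v ->
  is_derive t 1 (fun s => f (s *: v + x)) ('D_v f (t *: v + x)).
Proof.
move=> df.
have E : (fun h : R => h^-1 *: (((fun s => f (s *: v + x)) \o shift t) (h *: 1)
    - f (t *: v + x))) =
  (fun h : R => h^-1 *: ((f \o shift (t *: v + x)) (h *: v) - f (t *: v + x))).
  by apply/funext => h /=; rewrite [_%:A]mulr1 scalerDl addrA.
by split; rewrite /derivable /derive E.
Qed.

(** Restricted to the line through [x] in direction [v], the function [f] minus
    the parabola delta (c + t)^2 is maximal at t = 0.  In the application [c]
    is the coordinate of [x] in direction [v], which makes the parabola the
    restriction of delta |x|^2. *)
Lemma second_derivative_at_touching_le (R : realType) (V : normedModType R)
    (f : V -> R) (x v : V) (c delta : R) :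
  (forall y, derivable f y v) -> derivable ('D_v f) x v ->
  (forall t, f (t *: v + x) - f x <= delta * ((c + t) ^+ 2 - c ^+ 2)) ->
  'D_v ('D_v f) x <= 2 * delta.
Proof.
move=> df d2f touch.
pose phi t := f (t *: v + x) - delta * (c + t) ^+ 2.
pose dphi t := 'D_v f (t *: v + x) - 2 * delta * (c + t).
rewrite -subr_le0; apply: (@second_derivative_at_max_le0 R phi dphi 0).
- move=> t; have := is_derive_along_line (df (t *: v + x)) => L.
  by apply: is_derive_eq; rewrite /dphi /GRing.scale /=; ring.
- have /is_derive_along_line L : derivable ('D_v f) (0 *: v + x) v.
    by rewrite scale0r add0r.
  by apply: is_derive_eq; rewrite scale0r add0r /GRing.scale /=; ring.
move=> t; have := touch t; rewrite /phi scale0r add0r addr0; lra.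
Qed.

(** The Euclidean one: the norm carried by row vectors is the sup norm, whose
    square is not differentiable. *)
Definition sqnorm {R : realType} {d : nat} (x : 'rV[R]_d) : R :=
  \sum_(i < d) x 0 i ^+ 2.

(** Outside a large cube the penalty exceeds the oscillation of [f], so the
    maximum over the compact cube is global. *)
Lemma exists_max_of_penalized {R : realType} {d : nat} {f : 'rV[R]_d -> R}
    {delta : R} :
  continuous f -> [bounded f x | x in setT] -> 0 < delta ->
  exists x, forall y, f y - delta * sqnorm y <= f x - delta * sqnorm x.
Proof.
move=> cf bf delta0.
have [B [B0 fB]] : exists B, 0 <= B /\ forall x, `|f x| <= B.
  have [B Bgt0 hB] := ex_strict_bound_gt0 bf.
  by exists B; split; [exact: ltW | move=> x; exact/ltW/hB].
(* Some coordinate exceeds [r] off the cube, and [1 <= r] gives [r <= r ^+ 2]: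
   there the penalty is at least delta * r, which is more than 2 B. *)
pose r := 1 + 2 * B / delta.
have r1 : 1 <= r by rewrite lerDl divr_ge0 ?mulr_ge0 // ltW.
pose g (x : 'rV[R]_d) := f x - delta * sqnorm x.
pose A := [set x : 'rV[R]_d | forall i, x ord0 i \in `[- r, r]].
have A0 : A 0 by move=> i; rewrite mxE in_itv /=; lra.
have cA : compact A.
  by apply: (@rV_compact _ _ (fun=> `[- r, r]%classic)) => _; exact: segment_compact.
have cg : continuous g.
  move=> x.
  apply: (@continuousB _ _ _ f (fun z => delta * sqnorm z)); first exact: cf.
  apply: (@continuousM _ _ (cst delta)); first exact: cst_continuous.
  apply: continuous_big => [|i _]; first exact: add_continuous.
  by move=> z; apply: continuousM; exact: coord_continuous.
have [x _ xmax] := @EVT_max_rV R d g A (ex_intro _ _ A0) cA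
  (continuous_subspaceT cg).
exists x => y; rewrite -/(g x) -/(g y).
have [yA|yA] := pselect (A y); first by apply: xmax; rewrite inE.
apply: (@le_trans _ _ (g 0)); last by apply: xmax; rewrite inE.
have sq0 : sqnorm (0 : 'rV[R]_d) = 0.
  by rewrite /sqnorm big1// => i _; rewrite mxE expr0n.
have /existsNP[i /negP yi] := yA.
have sqy : r <= sqnorm y.
  rewrite /sqnorm (bigD1 i)//=; apply: ler_wpDr.
    by apply: sumr_ge0 => j _; rewrite sqr_ge0.
  move: yi; rewrite in_itv /= negb_and -!ltNge => /orP[]; nra.
have : 2 * B <= delta * sqnorm y.
  apply: (@le_trans _ _ (delta * r)); last by rewrite ler_pM2l.
  by rewrite /r mulrDr mulr1 mulrCA divff ?gt_eqF// mulr1 lerDr ltW.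
rewrite /g sq0; move: (fB y) (fB 0); rewrite !ler_norml; lra.
Qed.

Lemma laplacian_le_at_penalized_max {R : realType} {d : nat}
    {f : 'rV[R]_d -> R} {delta : R} {x : 'rV[R]_d} :
  bounded_classical f ->
  (forall y, f y - delta * sqnorm y <= f x - delta * sqnorm x) ->
  laplacian f x <= 2 * delta * d%:R.
Proof.
move=> [_ df _] xmax.
rewrite mulr_natr -[X in _ *+ X]card_ord -sumr_const; apply: ler_sum => i _.
apply: (@second_derivative_at_touching_le R _ f x (delta_mx 0 i) (x 0 i)).
- by move=> y; have [] := df i y.
- by have [_] := df i x.
move=> t; rewrite lerBlDl.
have -> : (x 0 i + t) ^+ 2 - x 0 i ^+ 2 =
    sqnorm (t *: delta_mx 0 i + x) - sqnorm x.
  rewrite /sqnorm (bigD1 i)//= [X in _ = _ - X](bigD1 i)//= !mxE !eqxx mulr1.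
  rewrite (eq_bigr (fun j => x 0 j ^+ 2)); first by ring.
  by move=> j /negPf ji; rewrite !mxE ji andbF mulr0 add0r.
by have := xmax (t *: delta_mx 0 i + x); lra.
Qed.

(** Asking for the differential inequality only where [f] exceeds [M] is what
    makes it applicable to equations with a zeroth-order term, whose sign is
    fixed there.  At the maximum point of the penalized function it gives
    f <= M + 2 d k delta, and this bound then holds at any fixed [x] up to the
    penalty delta |x|^2. *)
Lemma maximum_principle (R : realType) (d : nat) (f : 'rV[R]_d -> R) (k M : R) :
  bounded_classical f -> 0 <= k ->
  (forall x, M < f x -> f x - M <= k * laplacian f x) ->
  forall x, f x <= M.
Proof.
move=> bf k0 sub x; apply/ler_addgt0Pr => e e0.
have S0 (y : 'rV[R]_d) : 0 <= sqnorm y.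
  by apply: sumr_ge0 => i _; exact: sqr_ge0.
(* [C] is the total loss per unit of delta: the Laplacian bound plus the penalty
   at [x]; the extra 1 below keeps the denominator positive. *)
pose C := k * (2 * d%:R) + sqnorm x.
have C0 : 0 <= C by rewrite addr_ge0// !mulr_ge0.
pose delta := e / (C + 1).
have delta0 : 0 < delta by rewrite divr_gt0// ltr_wpDl.
have deltaC : delta * C <= e.
  by rewrite mulrAC ler_pdivrMr ?ltr_wpDl// ler_pM2l// lerDl.
have [cf _ bdf] := bf.
have [z zmax] := exists_max_of_penalized cf bdf delta0.
have lapz := laplacian_le_at_penalized_max bf zmax.
have fx : f x <= f z + delta * sqnorm x.
  have := zmax x; have := mulr_ge0 (ltW delta0) (S0 z); lra.
have K0 : 0 <= delta * (k * (2 * d%:R)).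
  by apply: mulr_ge0; [exact: ltW | rewrite !mulr_ge0].
have X0 := mulr_ge0 (ltW delta0) (S0 x).
move: deltaC; rewrite /C mulrDr => deltaC.
have [fzM|Mfz] := leP (f z) M; first by lra.
have := sub z Mfz; have := ler_wpM2l k0 lapz.
have -> : k * (2 * delta * d%:R) = delta * (k * (2 * d%:R)) by ring.
lra.
Qed.

Lemma partialN (R : realType) (d : nat) (f : 'rV[R]_d -> R) (i : 'I_d) :
  bounded_classical f -> partial i (- f) = - partial i f.
Proof.
by move=> [_ df _]; apply/funext => x; apply: deriveN; have [] := df i x.
Qed.

Lemma bounded_classicalN (R : realType) (d : nat) (f : 'rV[R]_d -> R) :
  bounded_classical f -> bounded_classical (- f).
Proof.
move=> fbc; have [cf df [B [Breal hB]]] := fbc; split.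
- by move=> x; apply: continuousN; exact: cf.
- move=> i x; rewrite partialN//; have [d1 d2] := df i x.
  by split; exact: derivableN.
- by exists B; split=> // b Bb x xT /=; rewrite normrN; exact: (hB _ Bb).
Qed.

Lemma laplacianN (R : realType) (d : nat) (f : 'rV[R]_d -> R) x :
  bounded_classical f -> laplacian (- f) x = - laplacian f x.
Proof.
move=> fbc; rewrite /laplacian -sumrN; apply: eq_bigr => i _.
rewrite partialN//; have [_ df _] := fbc.
by apply: deriveN; have [] := df i x.
Qed.

(** Nonnegativity comes first, from the maximum principle for [- f] with bound 0;
    it gives the reaction term the sign needed for the upper bound.  Extended
    real bounds [M] allow an essential supremum that may be infinite. *)
Lemma implicit_step_bounds {R : realType} {d : nat} {eps D tau : R}
    {f g : 'rV[R]_d -> R} (c : 'rV[R]_d -> R) :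
  0 < eps -> 0 < D -> 0 < tau -> bounded_classical f ->
  (forall x, 0 <= g x) -> (forall x, 0 <= c x) ->
  (forall x, (f x - g x) / tau - D * laplacian f x = - eps^-1 * (f x * c x)) ->
  (forall x, 0 <= f x) /\
  forall M : \bar R, (forall x, (g x)%:E <= M)%E -> forall x, ((f x)%:E <= M)%E.
Proof.
move=> eps0 D0 tau0 bf g0 c0 fE.
have k0 : 0 <= tau * D by rewrite mulr_ge0// ltW.
have lapE x : tau * D * laplacian f x = f x - g x + tau / eps * c x * f x.
  have -> : tau * D * laplacian f x =
      tau * ((f x - g x) / tau + eps^-1 * (f x * c x)).
    by rewrite -mulrA; congr (_ * _); have := fE x; lra.
  by field; rewrite !gt_eqF.
have a0 x : 0 <= tau / eps * c x by rewrite mulr_ge0// divr_ge0 ?ltW.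
have f0 x : 0 <= f x.
  rewrite -oppr_le0; apply: (@maximum_principle _ _ (- f) (tau * D) 0) => //.
    exact: bounded_classicalN.
  move=> y; rewrite laplacianN// subr0 mulrN lapE oppr_gt0 => fy.
  have := mulr_ge0_le0 (a0 y) (ltW fy); have := g0 y.
  have -> : (- f) y = - f y :> R by []; lra.
split=> // -[M gM x||gM x].
- rewrite lee_fin; apply: (@maximum_principle _ _ f (tau * D) M) => // y _.
  rewrite lapE; have := mulr_ge0 (a0 y) (f0 y); have := gM y.
  rewrite lee_fin; lra.
- by move=> _ x; exact: leey.
- by have := gM x.
Qed.

(** Solving for the new value: q = (p + s u) / (1 + s u + s v), s = tau / eps. *)
Lemma proportion_step_bounds (R : realType) (eps tau p q u v : R) :
  0 < eps -> 0 < tau -> 0 <= u -> 0 <= v -> 0 <= p <= 1 ->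
  (q - p) / tau = eps^-1 * ((1 - q) * u - v * q) -> 0 <= q <= 1.
Proof.
move=> eps0 tau0 u0 v0 /andP[p0 p1] qE.
pose s := tau / eps.
have s0 : 0 < s by rewrite divr_gt0.
have {}qE : q * (1 + s * (u + v)) = p + s * u.
  have : q - p = s * ((1 - q) * u - v * q).
    by rewrite /s -mulrA -qE mulrC divfK// gt_eqF.
  lra.
have D0 : 0 < 1 + s * (u + v) by rewrite ltr_pwDl// mulr_ge0 ?addr_ge0// ltW.
have su : 0 <= s * u by rewrite mulr_ge0// ltW.
have sv : 0 <= s * v by rewrite mulr_ge0// ltW.
apply/andP; split.
  by rewrite -(pmulr_lge0 q D0) qE; lra.
by rewrite -(ler_pM2r D0) qE; lra.
Qed.

Theorem lemma2p1 (R : realType) (d : nat) (eps lam d1 d2 tau : R)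
  (heps : 0 < eps) (hlam : 0 < lam) (hd1 : 0 < d1) (hd2 : 0 < d2)
  (htau : 0 < tau)
  (u v p : nat -> 'rV[R]_d -> R)
  (hscheme : scheme eps lam d1 d2 tau u v p)
  (hu0 : forall x, 0 <= u 0%N x /\ ((u 0%N x)%:E <= Linfty_norm (u 0%N))%E)
  (hv0 : forall x, 0 <= v 0%N x /\ ((v 0%N x)%:E <= Linfty_norm (v 0%N))%E)
  (hp0 : forall x, 0 <= p 0%N x <= 1) :
  forall (n : nat) (x : 'rV[R]_d),
    [/\ 0 <= u n x /\ ((u n x)%:E <= Linfty_norm (u 0%N))%E,
        0 <= v n x /\ ((v n x)%:E <= Linfty_norm (v 0%N))%E &
        0 <= p n x <= 1].
Proof.
elim=> [|n IH] => [x|]; first by split.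
have [bu bv sE] := hscheme n.
have u0 x : 0 <= u n x by have [[]] := IH x.
have v0 x : 0 <= v n x by have [_ []] := IH x.
have hp x : 0 <= p n.+1 x <= 1.
  have [_ _ hpn] := IH x; have [pE _ _] := sE x.
  exact: proportion_step_bounds heps htau (u0 x) (v0 x) hpn pE.
have p0 x : 0 <= lam * p n.+1 x.
  by have /andP[? _] := hp x; rewrite mulr_ge0// ltW.
have q0 x : 0 <= lam * (1 - p n.+1 x).
  by have /andP[_ ?] := hp x; rewrite mulr_ge0 ?subr_ge0// ltW.
have [uS0 uSM] := implicit_step_bounds
  (fun x => v n x + lam * (1 - p n.+1 x)) heps hd1 htau bu u0
  (fun x => addr_ge0 (v0 x) (q0 x)) (fun x => let: And3 _ uE _ := sE x in uE).
have [vS0 vSM] := implicit_step_bounds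
  (fun x => u n.+1 x + lam * p n.+1 x) heps hd2 htau bv v0
  (fun x => addr_ge0 (uS0 x) (p0 x)) (fun x => let: And3 _ _ vE := sE x in vE).
move=> x; split=> //; split=> //.
  by apply: uSM => y; have [[]] := IH y.
by apply: vSM => y; have [_ []] := IH y.
Qed.
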